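(* Let $-\frac1n<\alpha<0$, $\beta_1\ge0$, $\beta_2\in\mathbb{R}$. Let $f=(1-\alpha\varphi)^{1/\alpha}\in\mathcal{C}^+_\alpha(\mathbb{R}^n)$ with $o\in\mathrm{int}(K_f)$, and for $t>0$ small enough (so that it is well defined) set $$\widehat{f_t}(x)=\Big(1-\alpha\big[(1+\beta_1t)\varphi^*\big]^*(x)+\alpha\beta_2 t\Big)^{1/\alpha}=\Big(1-\alpha(1+\beta_1t)\varphi\big(\tfrac{x}{1+\beta_1 t}\big)+\alpha\beta_2t\Big)^{1/\alpha}.$$ Then $$\lim_{t\to0^+}\int_{\mathbb{R}^n}\frac{\widehat{f_t}(x)-f(x)}{t}\,dx=\beta_2\int_{\mathbb{R}^n}f(x)^{1-\alpha}\,dx+\beta_1\,\delta J_\alpha(f,f),$$ and this limit is a finite real number.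
   Context: $\mathrm{Conv}(\mathbb{R}^n)$ is the set of proper, convex, lower semi-continuous $\varphi:\mathbb{R}^n\to\mathbb{R}\cup\{+\infty\}$; $\varphi$ is coercive if $\liminf_{|x|\to\infty}\varphi(x)/|x|>0$. For $\alpha<0$, $\mathcal{C}^+_\alpha(\mathbb{R}^n)$ is the set of $f=(1-\alpha\varphi)^{1/\alpha}$ with $\varphi\in\mathrm{Conv}(\mathbb{R}^n)$ nonnegative and coercive (convention: $f=0$ where $\varphi=+\infty$). $K_f=\overline{\mathrm{dom}\,\varphi}$ is the support of $f$, where $\mathrm{dom}\,\varphi=\{\varphi<\infty\}$. The Legendre transform is $\varphi^*(y)=\sup_x\{\langle x,y\rangle-\varphi(x)\}$. For $\alpha$-concave $f=(1-\alpha\varphi)^{1/\alpha}$, $g=(1-\alpha\psi)^{1/\alpha}$ and $t>0$, $f\oplus_\alpha t\cdot_\alpha g:=(1-\alpha(\varphi^*+t\psi^* )^* )^{1/\alpha}$; $J(f)=\int f\,dx$; $\delta J_\alpha(f,g):=\lim_{t\to0^+}\frac{J(f\oplus_\alpha t\cdot_\alpha g)-J(f)}{t}$ (it is known that $\delta J_\alpha(f,f)=nJ(f)-\int\varphi f^{1-\alpha}dx$ is finite). *)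

(* Defs.v *)
From HB Require Import structures.
From mathcomp Require Import all_boot all_order all_algebra.
From mathcomp Require Import all_classical all_reals all_analysis.
Set Implicit Arguments. Unset Strict Implicit. Unset Printing Implicit Defensive.
Import Order.TTheory GRing.Theory Num.Def Num.Theory.
Import numFieldNormedType.Exports.
Local Open Scope classical_set_scope.
Local Open Scope ring_scope.

Section Defs.
Context {R : realType}.

Definition dotp {n : nat} (x y : 'rV[R]_n) : R := \sum_(i < n) x ord0 i * y ord0 i.

Definition vcons {m : nat} (x : R) (y : 'rV[R]_m) : 'rV[R]_m.+1 :=
  row_mx (\row_(i < 1) x) y.

(* Lebesgue integral over R^n of a nonnegative (measurable) function,
   computed as the iterated one-dimensional Lebesgue integral (Tonelli). *)
Fixpoint nnintRn (n : nat) : ('rV[R]_n -> \bar R) -> \bar R :=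
  match n with
  | 0 => fun f => f 0
  | m.+1 => fun f =>
      (\int[@lebesgue_measure R]_x nnintRn (fun y : 'rV[R]_m => f (vcons x y)))%E
  end.

Definition intRn {n : nat} (g : 'rV[R]_n -> R) : \bar R :=
  (nnintRn (fun x => (Num.max (g x) 0)%:E) - nnintRn (fun x => (Num.max (- g x) 0)%:E))%E.

Definition convex_ext {n : nat} (phi : 'rV[R]_n -> \bar R) :=
  forall (x y : 'rV[R]_n) (l : R), 0 <= l <= 1 ->
    (phi (l *: x + (1 - l) *: y)%R <= l%:E * phi x + (1 - l)%:E * phi y)%E.

Definition in_Conv {n : nat} (phi : 'rV[R]_n -> \bar R) :=
  [/\ forall x, phi x != -oo%E,
      exists x, phi x != +oo%E,
      convex_ext phi &
      lower_semicontinuous phi].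

Definition coercive {n : nat} (phi : 'rV[R]_n -> \bar R) :=
  exists c : R, 0 < c /\ exists r0 : R, forall x : 'rV[R]_n,
      r0 <= `|x| -> ((c * `|x|)%:E <= phi x)%E.

(* phi in Conv, nonnegative, coercive: f = (1 - alpha phi)^(1/alpha) is in C^+_alpha *)
Definition C_alpha_plus_fun {n : nat} (phi : 'rV[R]_n -> \bar R) :=
  [/\ in_Conv phi, forall x, (0 <= phi x)%E & coercive phi].

Definition legendre {n : nat} (phi : 'rV[R]_n -> \bar R) (y : 'rV[R]_n) : \bar R :=
  ereal_sup [set ((dotp x y)%:E - phi x)%E | x in [set: 'rV[R]_n]].

Definition alpha_fun {n : nat} (alpha : R) (psi : 'rV[R]_n -> \bar R) (x : 'rV[R]_n) : R :=
  if psi x == +oo%E then 0 else (1 - alpha * fine (psi x)) `^ (alpha^-1).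

Definition alpha_sum {n : nat} (alpha : R) (phi psi : 'rV[R]_n -> \bar R) (t : R) :
    'rV[R]_n -> R :=
  alpha_fun alpha (legendre (fun y => (legendre phi y + t%:E * legendre psi y)%E)).

Definition J {n : nat} (f : 'rV[R]_n -> R) : \bar R := intRn f.

Definition deltaJ {n : nat} (alpha : R) (phi psi : 'rV[R]_n -> \bar R) : \bar R :=
  lim ((fun t : R => ((J (alpha_sum alpha phi psi t) - J (alpha_fun alpha phi)) * (t^-1)%:E)%E)
         @ 0^'+).

Definition fhat {n : nat} (alpha beta1 beta2 : R) (phi : 'rV[R]_n -> \bar R) (t : R)
    (x : 'rV[R]_n) : R :=
  let h := legendre (fun y => ((1 + beta1 * t)%:E * legendre phi y)%E) in
  if h x == +oo%E then 0
  else (1 - alpha * fine (h x) + alpha * beta2 * t) `^ (alpha^-1).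

End Defs.

(* Main.v *)
(* Write s = 1 + beta1 t, p = -1/alpha > n, and u = 1 - alpha phi, so that
   f = u^-p and f^(1-alpha) = f / u. By Fenchel-Moreau (s phi^* )^*(x) = s phi(x/s),
   so \hat{f_t}(x) = G_t(x/s) with G_t = (1 - alpha s phi + alpha beta2 t)^-p, and
   dilation gives J(\hat{f_t}) = s^n \int G_t. The base of G_t is u (1 + t w), where
   w = beta1 (1 - 1/u) + alpha beta2 / u is bounded because u >= 1. Bernoulli-type
   inequalities then yield 0 <= G_t - (f - t p w f) <= C t^2 f uniformly in x, where
   p w f = p beta1 f - (p beta1 + beta2) f^(1-alpha). Integrating expands \int G_t to
   first order without any limit theorem, since f is integrable: coercivity gives
   f <= C (1 + |x|)^-p with p > n. The case beta1 = 1, beta2 = 0 computes deltaJ.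
   Fenchel-Moreau is obtained from the Moreau envelope of phi, whose minimizers carry
   subgradients, using phi >= 0. *)
Require Import Defs.
From HB Require Import structures.
From mathcomp Require Import all_boot all_order all_algebra.
From mathcomp Require Import all_classical all_reals all_analysis.
From mathcomp Require Import measurable_realfun ring lra.
Import Order.TTheory GRing.Theory Num.Def Num.Theory.
Import numFieldNormedType.Exports.
Local Open Scope classical_set_scope.
Local Open Scope ring_scope.
Set Implicit Arguments. Unset Strict Implicit. Unset Printing Implicit Defensive.

(** * Sigma-finiteness of product measures *)

Section ProductSigmaFinite.
Context d1 d2 (T1 : measurableType d1) (T2 : measurableType d2) (R : realType).
Variables (m1 : {sigma_finite_measure set T1 -> \bar R})
  (m2 : {sigma_finite_measure set T2 -> \bar R}).

Lemma product_measure_sigma_finite : sigma_finite setT (m1 \x m2)%E.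
Proof.
have /sigma_finiteP[F [TF ndF Foo]] := sigma_finiteT m1.
have /sigma_finiteP[G [TG ndG Goo]] := sigma_finiteT m2.
(* Both exhaustions are nondecreasing, so the diagonal rectangles already cover the product. *)
exists (fun n => F n `*` G n).
  apply/seteqP; split => // -[x y] _.
  have [i _ Fx] : (\bigcup_i F i) x by rewrite -TF.
  have [j _ Gy] : (\bigcup_j G j) y by rewrite -TG.
  exists (maxn i j) => //; split.
    by move: x Fx; exact/subsetPset/ndF/leq_maxl.
  by move: y Gy; exact/subsetPset/ndG/leq_maxr.
move=> k; have [mF Fk] := Foo k; have [mG Gk] := Goo k.
split; first exact: measurableX.
by rewrite product_measure1E// lte_mul_pinfty// ge0_fin_numE.
Qed.

(* MathComp-Analysis declares [m1 \x m2] as a measure instance only. *)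
Definition product_sigma_finite_measure :
    {sigma_finite_measure set (T1 * T2)%type -> \bar R} :=
  HB.pack_for {sigma_finite_measure set (T1 * T2)%type -> \bar R} (m1 \x m2)%E
    (@Measure_isSigmaFinite.Build _ _ _ (m1 \x m2)%E product_measure_sigma_finite).

End ProductSigmaFinite.

(** * Iterated integrals and their behaviour under dilation *)

Section Iterated.
Context {R : realType}.
Implicit Types n : nat.

Lemma vconsZ m (c x : R) (y : 'rV[R]_m) : c *: vcons x y = vcons (c * x) (c *: y).
Proof.
apply/rowP => i; rewrite /vcons !mxE.
by case: fintype.split => j; rewrite !mxE.
Qed.

(** Uniqueness of Lebesgue measure: the image of Lebesgue measure under $x \mapsto c^{-1}x$,
    multiplied by $c^{-1}$, gives half-open intervals their length. *)
Lemma ge0_integral_dilation (H : R -> \bar R) (c : R) :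
  0 < c -> (forall x, 0 <= H x)%E -> measurable_fun [set: R] H ->
  (\int[@lebesgue_measure R]_x H (c^-1 * x)%R)%E =
  (c%:E * \int[@lebesgue_measure R]_x H x)%E.
Proof.
move=> c0 H0 mH.
pose d : measurableTypeR R -> measurableTypeR R := fun x => c^-1 * x.
have md : measurable_fun setT d by exact: measurable_funM.
have cV0 : 0 <= c^-1 by rewrite invr_ge0 ltW.
(* The instance is named because inference cannot find [md]. *)
pose P : {measure set (measurableTypeR R) -> \bar R} :=
  measure_function_pushforward__canonical__measure_function_Measure
    (@lebesgue_measure R) md.
pose nu := mscale (NngNum cV0) P.
have nuE A : measurable A -> @lebesgue_measure R A = nu A.
  apply: lebesgue_measure_unique => _ [[a b]] _ <-.
  rewrite /nu/= /mscale/= /pushforward.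
  have -> : d @^-1` `]a, b]%classic = `]c * a, c * b]%classic.
    apply/seteqP; split => x /=; rewrite !in_itv/= /d;
      by rewrite ltr_pdivlMl// ler_pdivrMl.
  rewrite !lebesgue_measure_itv/= !lte_fin ltr_pM2l//.
  case: ifPn => _; last by rewrite mule0.
  by rewrite -!EFinB -EFinM -mulrBr mulKf ?gt_eqF.
transitivity (\int[pushforward (@lebesgue_measure R) d]_x H x)%E.
  by rewrite ge0_integral_pushforward.
transitivity (c%:E * \int[nu]_x H x)%E; last first.
  congr (_ * _)%E; apply: eq_measure_integral => A mA _; exact/esym/nuE.
rewrite /nu ge0_integral_mscale// muleA -EFinM divff ?gt_eqF// mul1e//.
Qed.

(* [nnintRn] is a recursive function on ['rV_n], which carries no sigma-algebra;
   this realizes it as a Lebesgue integral on an n-fold product of lines. *)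
Lemma nnintRn_representation n :
  exists (d : measure_display) (T : measurableType d)
    (mu : {sigma_finite_measure set T -> \bar R}) (e : T -> 'rV[R]_n),
  [/\ forall i, measurable_fun setT (fun z => e z ord0 i),
      forall c : R, exists2 D : T -> T, measurable_fun setT D &
        forall z, e (D z) = c *: e z,
      forall g, (forall x, 0 <= g x)%E -> measurable_fun setT (g \o e) ->
        nnintRn g = (\int[mu]_z g (e z))%E &
      forall g (c : R), 0 < c -> (forall x, 0 <= g x)%E ->
        measurable_fun setT (g \o e) ->
        nnintRn (fun x => g (c^-1 *: x)) = ((c ^+ n)%:E * nnintRn g)%E].
Proof.
elim: n => [|m [d [T [mu [e [me De Ie Se]]]]]].
  exists _, unit, (@dirac _ unit tt R), (fun=> 0); split.
  - by case.
  - by move=> c; exists id => // _; rewrite scaler0.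
  - by move=> g g0 mg /=; rewrite integral_dirac// diracT mul1e.
  - by move=> g c _ _ _ /=; rewrite expr0 mul1e scaler0.
pose leb : {sigma_finite_measure set (measurableTypeR R) -> \bar R} :=
  @lebesgue_measure R.
pose e' := fun z : measurableTypeR R * T => vcons z.1 (e z.2).
have Ie' g : (forall x, 0 <= g x)%E -> measurable_fun setT (g \o e') ->
    (fun x => nnintRn (fun y => g (vcons x y))) = fubini_F mu (g \o e').
  move=> g0 mg; apply/funext => x; rewrite /fubini_F/= Ie//.
  by have := measurable_fun_pair2 x mg.
exists _, (measurableTypeR R * T)%type, (product_sigma_finite_measure leb mu), e'; split.
- move=> i; rewrite /e' /vcons.
  case: (@split_ordP 1 m i) => j ->.
    rewrite (_ : (fun _ => _) = fst) //; apply/funext => z.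
    by rewrite [LHS](@row_mxEl _ 1 1 m) mxE.
  rewrite (_ : (fun _ => _) = (fun y => e y ord0 j) \o snd).
    exact: measurableT_comp.
  by apply/funext => z; exact: (@row_mxEr _ 1 1 m).
(* Scaling lifts to the parameter space one factor at a time; this is what later makes dilated
   functions measurable. *)
- move=> c; have [D mD DE] := De c.
  exists (fun z => (c * z.1, D z.2)).
    apply: measurable_fun_pair; first exact: measurable_funM.
    exact: measurableT_comp.
  by move=> z; rewrite /e' /= DE vconsZ.
- move=> g g0 mg /=; rewrite Ie'//.
  by apply/esym/(@fubini_tonelli1 _ _ _ _ _ leb mu (g \o e') mg) => x; exact: g0.
- move=> g c c0 g0 mg /=.
  have mF : measurable_fun setT (fubini_F mu (g \o e')).
    by apply: measurable_fun_fubini_tonelli_F => // z; exact: g0.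
  have F0 x : (0 <= fubini_F mu (g \o e') x)%E.
    by apply: integral_ge0 => *; exact: g0.
  (* The induction hypothesis scales the last $m$ coordinates and yields $c^m$; the dilation of the
     first coordinate supplies the remaining factor $c$. *)
  under eq_integral => x _.
    under [X in nnintRn X]eq_fun do rewrite vconsZ.
    rewrite (Se (fun y => g (vcons (c^-1 * x) y)))//; last first.
      by have := measurable_fun_pair2 (c^-1 * x) mg.
    rewrite -[nnintRn _]/((fun x => nnintRn (fun y => g (vcons x y))) (c^-1 * x)).
    rewrite Ie'//.
    over.
  rewrite ge0_integralZl_EFin//; last 2 first.
    by apply: measurableT_comp mF _; exact: measurable_funM.
    by rewrite exprn_ge0// ltW.
  by rewrite ge0_integral_dilation// Ie'// muleA -EFinM exprSr.
Qed.
End Iterated.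

(** * Measurability of lower semicontinuous functions along a map into $\mathbb{R}^n$ *)

Section Coordinates.
Context {R : realType} {n : nat}.
Implicit Types (x y : 'rV[R]_n) (phi : 'rV[R]_n -> \bar R).

Lemma rV_norm_lt x (e : R) : 0 < e ->
  `|x| < e <-> forall i, `|x ord0 i| < e.
Proof.
move=> e0; rewrite /normr/= mx_normrE; split.
  by move=> /bigmax_ltP[_ xe] i; exact: (xe (ord0, i)).
by move=> xe; apply/bigmax_ltP; split => // -[i j] _; rewrite (ord1 i) xe.
Qed.

Lemma coord_le_norm x i : `|x ord0 i| <= `|x|.
Proof.
rewrite [leRHS]/normr/= mx_normrE.
exact: (le_bigmax _ (fun k : 'I_1 * 'I_n => `|x k.1 k.2|) (ord0, i)).
Qed.

Context d (T : measurableType d) (e : T -> 'rV[R]_n).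
Hypothesis me : forall i, measurable_fun setT (fun z => e z ord0 i).

(** The norm is the maximum norm, so a ball is a finite intersection of coordinate strips. *)
Lemma measurable_preimage_ball x (r : R) : 0 < r ->
  measurable (e @^-1` [set y | `|x - y| < r]).
Proof.
move=> r0.
have -> : e @^-1` [set y | `|x - y| < r] =
    ~` (\bigcup_i ~` [set z | `|x ord0 i - e z ord0 i| < r]).
  rewrite setC_bigcup; apply/seteqP; split => [z /= /(rV_norm_lt _ r0) H i _|z H].
    by rewrite setCK /=; have := H i; rewrite !mxE.
  apply/(rV_norm_lt _ r0) => i; have := H i I.
  by rewrite setCK /= !mxE.
apply: measurableC; apply: countable_bigcupT_measurable => [|i]; first exact: countableP.
apply: measurableC; rewrite -[X in measurable X]setTI.
have mf : measurable_fun setT (fun z => `|x ord0 i - e z ord0 i|).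
  by apply: measurableT_comp => //; exact: measurable_funB.
have := mf measurableT _ (measurable_itv `]-oo, r[).
by congr measurable; apply/seteqP; split => z /=; rewrite in_itv/=.
Qed.

(** Second countability made explicit: $U$ is the union of the balls with rational center and radius
    $1/(k+1)$ that lie inside $U$. *)
Lemma measurable_preimage_open (U : set 'rV[R]_n) :
  open U -> measurable (e @^-1` U).
Proof.
move=> oU.
pose B (p : 'rV[rat]_n * nat) : set 'rV[R]_n :=
  [set y | `|map_mx ratr p.1 - y| < p.2.+1%:R^-1].
pose F p : set 'rV[R]_n := if `[< B p `<=` U >] then B p else set0.
have -> : U = \bigcup_p F p.
  apply/seteqP; split => [x Ux|x [p _]]; last first.
    by rewrite /F; case: asboolP => // BU; exact: BU.
  have /nbhs_ballP[r /= r0 rU] : nbhs x U by exact: open_nbhs_nbhs.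
  (* A ball of radius below $r/2$ that contains $x$ stays within distance $r$ of $x$. *)
  have [k kr] : exists k : nat, k.+1%:R^-1 < r / 2.
    by near \oo => k; exists k; near: k; apply: near_infty_natSinv_lt (PosNum _);
      rewrite divr_gt0.
  have k0 : 0 < k.+1%:R^-1 :> R by rewrite invr_gt0.
  have /choice[q qx] i : exists q : rat, `|ratr q - x ord0 i| < k.+1%:R^-1.
    have /rat_in_itvoo[q] : x ord0 i - k.+1%:R^-1 < x ord0 i + k.+1%:R^-1.
      by rewrite ltrD2l gtrN.
    by rewrite in_itv/= => xq; exists q; rewrite ltr_distl.
  have Bx : B (\row_i q i, k) x.
    by apply/rV_norm_lt => // i; rewrite !mxE.
  exists (\row_i q i, k) => //; rewrite /F; case: asboolP => // NBU.
  exfalso; apply: NBU => y By; apply: rU; rewrite -ball_normE /=.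
  rewrite (splitr r) -(subrKA (map_mx ratr (\row_i q i))).
  rewrite (le_lt_trans (ler_normD _ _))// ltrD// ?(lt_trans _ kr)//.
  by rewrite distrC.
rewrite preimage_bigcup; apply: countable_bigcupT_measurable => [|p].
  exact: countableP.
rewrite /F; case: asboolP => _; last by rewrite preimage_set0.
by apply: measurable_preimage_ball; rewrite invr_gt0.
Unshelve. all: by end_near. Qed.

Lemma measurable_fun_lower_semicontinuous phi :
  lower_semicontinuous phi -> measurable_fun setT (phi \o e).
Proof.
move=> lphi; apply: (measurability _ (ErealGenOInfty.measurableE R)).
move=> /= _ [_ [a ->]] <-; apply: measurableI => //.
rewrite preimage_itvoy; apply: (measurable_preimage_open (U := [set x | (a%:E < phi x)%E])).
by move/lower_semicontinuousP : lphi; exact.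
Qed.


End Coordinates.

(** * Bernoulli-type bounds for powers, and integrable power tails on the line *)

Section PowerTails.
Context {R : realType}.

(** Everything follows from $e^y \ge 1+y$ and $\ln u \le u-1$. The lower bound is direct; the upper
    bound inverts a lower bound for $(1+z)^p$. *)
Lemma powR_taylor1 (p z : R) : 0 <= p -> (p + 1) * `|z| <= 2^-1 ->
  0 <= (1 + z) `^ (- p) - (1 - p * z) <= 2 * p * (p + 1) * z ^+ 2.
Proof.
move=> p0 zp.
have : `|(p + 1) * z| <= 2^-1 by rewrite normrM (ger0_norm (_ : 0 <= p + 1))// addr_ge0.
rewrite ler_norml => /andP[zl zr].
have : `|z| <= 2^-1.
  by rewrite (le_trans _ zp)// ler_peMl// lerDr.
rewrite ler_norml => /andP[z1 z2].
have z0 : 0 < 1 + z by lra.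
have powE q : (1 + z) `^ q = expR (q * ln (1 + z)) by rewrite /powR gt_eqF.
have lnle : ln (1 + z) <= z by apply: le_ln1Dx; lra.
(* [ln (1 + z) >= z / (1 + z)], from [ln u <= u - 1] at [u = (1 + z)^-1] *)
have lnge : z / (1 + z) <= ln (1 + z).
  rewrite -[leRHS]opprK -lnV ?posrE// lerNr.
  rewrite [X in ln X](_ : _ = 1 + - (z / (1 + z))); last by field; rewrite gt_eqF.
  apply: le_ln1Dx; rewrite ltrN2 ltr_pdivrMr//; lra.
apply/andP; split.
  rewrite subr_ge0 powE (le_trans _ (expR_ge1Dx _))// mulNr lerD2l lerN2.
  exact: ler_wpM2l.
have D0 : 0 < 1 + (p + 1) * z by lra.
have C0 : 0 <= p * (p + 1) * z ^+ 2 by rewrite mulr_ge0 ?sqr_ge0// mulr_ge0//; lra.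
have pow_ge : 1 + p * (z / (1 + z)) <= (1 + z) `^ p.
  by rewrite powE (le_trans _ (expR_ge1Dx _))// lerD2l ler_wpM2l.
have E : 1 + p * (z / (1 + z)) = (1 + (p + 1) * z) / (1 + z).
  by field; rewrite gt_eqF.
have : (1 + z) `^ (- p) <= (1 + z) / (1 + (p + 1) * z).
  rewrite powRN -[leRHS]invf_div lef_pV2 ?posrE ?divr_gt0 ?powR_gt0//.
  by rewrite -E.
rewrite lerBlDr => /le_trans; apply.
(* The remainder is exact; its denominator is at least $1/2$, which produces the constant 2. *)
have -> : (1 + z) / (1 + (p + 1) * z) =
    1 - p * z + p * (p + 1) * z ^+ 2 / (1 + (p + 1) * z).
  by field; rewrite gt_eqF.
rewrite addrC lerD2r ler_pdivrMr//.
have -> : 2 * p * (p + 1) * z ^+ 2 = p * (p + 1) * z ^+ 2 * 2 by ring.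
by rewrite -(mulrA _ 2) ler_peMr//; lra.
Qed.

Lemma continuous_power_tail (q : R) : continuous (fun x : R => (1 + `|x|) `^ (- q)).
Proof.
move=> x; have x1 : 0 < 1 + `|x| by rewrite ltr_pwDl.
apply: (@continuous_comp _ _ _ (fun x : R => 1 + `|x|) (@powR R ^~ (- q))).
  by apply: cvgD; [exact: cvg_cst|exact: norm_continuous].
apply: differentiable_continuous; apply/derivable1_diffP.
by apply: derivable_powR; rewrite in_itv/= andbT.
Qed.

(** Evenness reduces to the half-line, where $(1+x)^{1-q}/(1-q)$ is an antiderivative vanishing at
    infinity. *)
Lemma integral_power_tail_lty (q : R) : 1 < q ->
  (\int[@lebesgue_measure R]_x ((1 + `|x|) `^ (- q))%:E < +oo)%E.
Proof.
move=> q1.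
have f0 x : 0 <= (1 + `|x|) `^ (- q) :> R by exact: powR_ge0.
rewrite ge0_symfun_integralT//; last 2 first.
- exact: continuous_power_tail.
- by move=> x /=; rewrite normrN.
pose F (x : R) := (1 - q)^-1 * (1 + x) `^ (1 - q).
have F'E (x : R) : 0 < x -> is_derive x 1 F ((1 + `|x|) `^ (- q)).
  move=> x0.
  have x1 : 0 < 1 + x by rewrite ltr_pwDl// ltW.
  have d1 : is_derive x 1 (fun y : R => 1 + y) 1.
    by rewrite -[X in is_derive _ _ _ X]add0r; exact: is_deriveD.
  have d2 := is_derive1_powR (1 - q) x1.
  have d3 : is_derive x 1 (fun y => (1 + y) `^ (1 - q)) ((1 - q) * (1 + x) `^ (- q)).
    have := @is_derive1_comp _ (@powR R ^~ (1 - q)) (fun y => 1 + y) x _ _ d2 d1.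
    by rewrite mulr1 -addrAC subrr add0r.
  have := @is_deriveZ _ _ _ _ (1 - q)^-1 _ _ _ d3.
  rewrite (gtr0_norm x0) /GRing.scale/= mulKf//.
  by rewrite subr_eq0 lt_eqF.
rewrite (_ : [set x | 0 <= x] = `[0, +oo[%classic); last first.
  by apply/seteqP; split => x /=; rewrite in_itv/= andbT.
rewrite (@ge0_continuous_FTC2y _ _ F _ 0)//.
- by rewrite -EFinB -EFinM ltry.
- by apply: continuous_subspaceT; exact: continuous_power_tail.
- rewrite -(mulr0 (1 - q)^-1); apply: cvgMr.
  apply: (@cvg_trans _ ((expR \o -%R) (((q - 1) * ln (1 + x))) @[x --> +oo])).
    apply: near_eq_cvg; near=> x.
    have x0 : 0 < 1 + x by rewrite ltr_pwDl//; near: x; exact: nbhs_pinfty_ge.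
    by rewrite /= /powR gt_eqF// -mulNr opprB.
  apply: (@cvg_comp _ _ _ (fun x : R => (q - 1) * ln (1 + x)) (expR \o -%R)
    _ (pinfty_nbhs R)); last exact: cvgr_expR.
  apply: gt0_cvgMry; first by rewrite subr_gt0.
  apply: (@cvg_comp _ _ _ (fun x : R => 1 + x) (@ln R) _ (pinfty_nbhs R)).
    exact: cvg_addrl.
  apply/cvgryPge => A; near=> x.
  have x0 : 0 < x by near: x; apply: nbhs_pinfty_gt; rewrite num_real.
  rewrite -(expRK A) ler_ln ?posrE ?expR_gt0//; near: x.
- by move=> x x0; have [] := F'E x x0.
- apply: cvg_at_right_filter; apply: cvgMr.
  suff : {for (0 : R), continuous (fun y : R => (1 + y) `^ (1 - q))} by [].
  apply: differentiable_continuous; apply/derivable1_diffP.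
  have d1 : is_derive (0 : R) 1 (fun y : R => 1 + y) 1.
    by rewrite -[X in is_derive _ _ _ X]add0r; exact: is_deriveD.
  have x1 : 0 < 1 + 0 :> R by rewrite addr0.
  have d2 := is_derive1_powR (1 - q) x1.
  by have [] := @is_derive1_comp _ (@powR R ^~ (1 - q)) (fun y => 1 + y) 0 _ _ d2 d1.
- move=> x; rewrite in_itv/= andbT => x0; rewrite derive1E; have [] := F'E x x0.
Unshelve. all: by end_near. Qed.
End PowerTails.

(** * Product majorant of the power tail on $\mathbb{R}^n$ *)

Section ProductTail.
Context {R : realType}.

Lemma vcons0 m (x : R) (y : 'rV[R]_m) : vcons x y ord0 ord0 = x.
Proof. by rewrite /vcons mxE; case: fintype.splitP => // j _; rewrite mxE. Qed.

Lemma vcons_lift m (x : R) (y : 'rV[R]_m) i :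
  vcons x y ord0 (lift ord0 i) = y ord0 i.
Proof.
rewrite /vcons mxE; case: fintype.splitP => j /= ij; last first.
  by congr (y _ _); apply/val_inj; case: ij.
by have := ltn_ord j; rewrite -ij.
Qed.

(** The factor $c$ is there for the induction, which absorbs the value of $g$ at the first
    coordinate into it. *)
Lemma nnintRn_prod n (g : R -> R) (I c : R) :
  (forall x, 0 <= g x) -> measurable_fun [set: R] g ->
  (\int[@lebesgue_measure R]_x (g x)%:E = I%:E)%E -> 0 <= c ->
  nnintRn (fun x : 'rV[R]_n => (c * \prod_(i < n) g (x ord0 i))%:E) =
  (c * I ^+ n)%:E.
Proof.
move=> g0 mg gI; elim: n c => [|m IH] c c0 /=; first by rewrite big_ord0 expr0.
have I0 : 0 <= I by rewrite -lee_fin -gI; apply: integral_ge0 => x _; rewrite lee_fin.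
under eq_integral => x _.
  under [X in nnintRn X]eq_fun => y.
    rewrite big_ord_recl mulrA.
    rewrite vcons0; under eq_bigr => i _ do rewrite vcons_lift.
    over.
  rewrite IH ?mulr_ge0// mulrAC EFinM.
  over.
rewrite ge0_integralZl_EFin//.
- by rewrite gI -EFinM exprSr mulrA.
- by move=> x _; rewrite lee_fin.
- exact/measurable_EFinP.
- by rewrite mulr_ge0// exprn_ge0.
Qed.

(** Each coordinate takes an equal share of the exponent, and $|x_i| \le |x|$. The product is
    integrable once $p/(n+1) > 1$. *)
Lemma norm_tail_le_prod n (p : R) (x : 'rV[R]_n.+1) : 0 <= p ->
  (1 + `|x|) `^ (- p) <= \prod_(i < n.+1) (1 + `|x ord0 i|) `^ (- (p / n.+1%:R)).
Proof.
move=> p0; have q0 : 0 <= p / n.+1%:R by rewrite divr_ge0.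
have -> : (1 + `|x|) `^ (- p) = \prod_(i < n.+1) (1 + `|x|) `^ (- (p / n.+1%:R)).
  rewrite prodr_const card_ord -powR_mulrn ?powR_ge0// -powRrM mulNr divfK//.
apply: ler_prod => i _; rewrite powR_ge0/= !powRN lef_pV2 ?posrE ?powR_gt0 ?ltr_pwDl//.
by apply: ge0_ler_powR => //; rewrite ?nnegrE ?addr_ge0// lerD2l coord_le_norm.
Qed.

End ProductTail.

(** * Minimization of lower semicontinuous functions *)

Section FenchelMoreau.
Context {R : realType}.

Lemma ereal_lt_between (x y : \bar R) : (x < y)%E ->
  exists r : R, (x < r%:E < y)%E.
Proof.
case: x => [x| |]; case: y => [y| |]//.
- rewrite lte_fin => xy; exists ((x + y) / 2); rewrite !lte_fin; lra.
- by move=> _; exists (x + 1); rewrite lte_fin ltry ltrDl ltr01.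
- by move=> _; exists (y - 1); rewrite lte_fin ltNyr gtrDl ltrN10.
- by move=> _; exists 0; rewrite ltNyr ltry.
Qed.

(** The sublevel sets $\{F < b\}$ in $K$, for $b > \inf_K F$, generate a filter. It has a cluster
    point $p$ in $K$, and lower semicontinuity excludes $F(p) > \inf_K F$. *)
Lemma lower_semicontinuous_argmin (X : topologicalType) (F : X -> \bar R)
  (K : set X) : compact K -> K !=set0 -> lower_semicontinuous F ->
  exists2 p, K p & forall z, K z -> (F p <= F z)%E.
Proof.
move=> cK [z0 Kz0] lF; set m := ereal_inf (F @` K).
have mF z : K z -> (m <= F z)%E by move=> Kz; apply: ereal_inf_lbound; exists z.
have [moo|] := eqVneq m +oo%E.
  (* Here $F$ is $+\infty$ on all of $K$, and any point is a minimizer. *)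
  exists z0 => // z Kz; have := mF _ Kz; rewrite moo leye_eq => /eqP ->.
  exact: leey.
rewrite -ltey => mlt.
pose G := filter_from [set b : R | (m < b%:E)%E] (fun b => [set z | K z /\ (F z < b%:E)%E]).
have GF : ProperFilter G.
  apply: filter_from_proper; last first.
    by move=> b /= /ereal_inf_lt[_ [z Kz <-] zb]; exists z.
  apply: filter_from_filter.
    by have [b /andP[mb _]] := ereal_lt_between mlt; exists b.
  move=> b c /= mb mc; exists (Num.min b c).
    by rewrite /= EFin_min lt_min mb.
  by move=> z /= []; rewrite EFin_min lt_min => Kz /andP[].
have GK : G K.
  by have [b /andP[mb _]] := ereal_lt_between mlt; exists b => // z [].
have [p [Kp clp]] := cK G GF GK.
exists p => // z Kz; apply: le_trans (mF _ Kz).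
rewrite leNgt; apply/negP => /ereal_lt_between[b /andP[mb bF]].
have [V pV VF] := lF p b bF.
have Gb : G [set z | K z /\ (F z < b%:E)%E] by exists b.
have [w [[_ wb]]] := clp _ V Gb pV.
by move/VF => /(lt_trans wb); rewrite ltxx.
Qed.

Lemma lower_semicontinuousD_continuous (X : topologicalType) (phi : X -> \bar R)
  (g : X -> R) : lower_semicontinuous phi -> continuous g ->
  lower_semicontinuous (fun x => phi x + (g x)%:E)%E.
Proof.
move=> lphi cg x a; rewrite -lteBlDr// -EFinB => /ereal_lt_between[b /andP[ab bphi]].
have [V xV Vphi] := lphi x b bphi.
have gx : nbhs x [set y | a - b < g y].
  apply: (cg x [set r | a - b < r]); apply: open_nbhs_nbhs; split; first exact: open_gt.
  by move: ab; rewrite /= lte_fin; lra.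
exists (V `&` [set y | a - b < g y]); first exact: filterI.
move=> y [/Vphi bphiy /= gy].
rewrite -lteBlDr// -EFinB (le_lt_trans _ bphiy)// lee_fin; lra.
Qed.

(** * The Euclidean inner product on row vectors *)

Section Dotp.
Context {n : nat}.
Implicit Types x y z : 'rV[R]_n.

Lemma dotpC x y : dotp x y = dotp y x.
Proof. by rewrite /dotp; apply: eq_bigr => i _; rewrite mulrC. Qed.

Lemma dotpDl x y z : dotp (x + y) z = dotp x z + dotp y z.
Proof. by rewrite /dotp -big_split; apply: eq_bigr => i _; rewrite mxE mulrDl. Qed.

Lemma dotpZl (c : R) x y : dotp (c *: x) y = c * dotp x y.
Proof. by rewrite /dotp mulr_sumr; apply: eq_bigr => i _; rewrite mxE mulrA. Qed.

Lemma dotpDr x y z : dotp z (x + y) = dotp z x + dotp z y.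
Proof. by rewrite !(dotpC z) dotpDl. Qed.

Lemma dotpZr (c : R) x y : dotp y (c *: x) = c * dotp y x.
Proof. by rewrite !(dotpC y) dotpZl. Qed.

Lemma dotpNr x y : dotp y (- x) = - dotp y x.
Proof. by rewrite -scaleN1r dotpZr mulN1r. Qed.

Lemma sqdistD (l : R) x y : dotp (x + l *: y) (x + l *: y) =
  dotp x x + 2 * l * dotp x y + l ^+ 2 * dotp y y.
Proof. by rewrite !(dotpDl, dotpDr) !(dotpZl, dotpZr) (dotpC y x); ring. Qed.

(** Links the two norms in play: balls use the maximum norm, the Moreau envelope the Euclidean
    one. *)
Lemma sqr_norm_le_dotp x : `|x| ^+ 2 <= dotp x x.
Proof.
have dE : dotp x x = \sum_(i < n) (x ord0 i) ^+ 2.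
  by apply: eq_bigr => i _; rewrite expr2.
have [x0|/mx_norm_neq0[[j i] /= xi]] := eqVneq (mx_norm x) 0.
  have -> : `|x| = 0 := x0.
  by rewrite expr0n/= dE sumr_ge0// => i _; rewrite sqr_ge0.
have -> : `|x| = `|x j i| := xi.
rewrite (ord1 j) real_normK ?num_real// dE (bigD1 i)//= lerDl.
by rewrite sumr_ge0// => k _; rewrite sqr_ge0.
Qed.

Lemma dotp_ge0 x : 0 <= dotp x x.
Proof. by rewrite (le_trans _ (sqr_norm_le_dotp x))// sqr_ge0. Qed.

Lemma continuous_sqdist x0 : continuous (fun z => dotp (z - x0) (z - x0)).
Proof.
rewrite /dotp; apply: continuous_big => [|i _ z]; first exact: add_continuous.
have c : {for z, continuous (fun z : 'rV[R]_n => z ord0 i - x0 ord0 i)}.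
  apply: (@continuous_comp _ R R (fun z : 'rV[R]_n => z ord0 i) (fun r => r - x0 ord0 i)).
    exact: (@coord_continuous R _ n ord0 i z).
  by apply: cvgB; [exact: cvg_id|exact: cvg_cst].
rewrite [X in continuous_at _ X](_ : _ =
    (fun z => (z ord0 i - x0 ord0 i) * (z ord0 i - x0 ord0 i))).
  exact: (cvgM c c).
by apply/funext => w; rewrite !mxE.
Qed.

End Dotp.

(** * Moreau envelope, affine minorants and biconjugation *)

Section Biconjugate.
Context {n : nat} (phi : 'rV[R]_n -> \bar R).
Hypotheses (cphi : in_Conv phi) (phi0 : forall x, (0 <= phi x)%E).

(** Since $\varphi \ge 0$, outside a large box the quadratic term alone is at least the value at a
    point [z1] of the domain, so a minimizer over the compact box is global. *)
Lemma moreau_envelope_argmin (k : R) (x0 : 'rV[R]_n) : 0 < k ->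
  exists p v, phi p = v%:E /\
    forall z, ((v + k * dotp (p - x0) (p - x0))%:E <=
      phi z + (k * dotp (z - x0) (z - x0))%:E)%E.
Proof.
move=> k0; case: cphi => phiN [z1 z1oo] _ lphi.
pose F z := (phi z + (k * dotp (z - x0) (z - x0))%:E)%E.
have lF : lower_semicontinuous F.
  apply: lower_semicontinuousD_continuous => // z.
  exact: (cvgM (cvg_cst k) (@continuous_sqdist _ x0 z)).
have phi_ge z : (phi z <= F z)%E.
  by rewrite leeDl// lee_fin mulr_ge0 ?dotp_ge0 ?ltW.
have quad_ge z : ((k * dotp (z - x0) (z - x0))%:E <= F z)%E by rewrite leeDr.
have [M FM] : exists M, F z1 = M%:E.
  move: (phiN z1) z1oo; rewrite /F; case: (phi z1) => [w| |]// _ _.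
  by exists (w + k * dotp (z1 - x0) (z1 - x0)); rewrite EFinD.
(* The first bound puts [z1] in the box. Outside the box $|z-x_0| \ge 1+M/k \ge 1$, hence
   $k|z-x_0|^2 \ge M$. *)
pose rho := Num.max `|z1 - x0| (1 + M / k).
pose K : set 'rV[R]_n :=
  [set z | forall i, `[x0 ord0 i - rho, x0 ord0 i + rho]%classic (z ord0 i)].
have KP z : K z <-> forall i, `|(z - x0) ord0 i| <= rho.
  by split=> H i; move: (H i); rewrite !mxE /= in_itv/= ler_distl.
have cK : compact K.
  apply: (@rV_compact R n (fun i => `[x0 ord0 i - rho, x0 ord0 i + rho]%classic)).
  by move=> i; exact: segment_compact.
have Kz1 : K z1.
  by apply/KP => i; rewrite (le_trans (coord_le_norm _ _))// le_max lexx.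
have [p Kp pmin] := lower_semicontinuous_argmin cK (ex_intro _ z1 Kz1) lF.
have Fp_le : (F p <= M%:E)%E by rewrite -FM pmin.
have M0 : 0 <= M.
  by rewrite -lee_fin; apply: le_trans Fp_le; apply: le_trans (phi_ge p).
have {}pmin z : (F p <= F z)%E.
  have [/pmin //|/KP/existsNP[i /negP]] := pselect (K z).
  rewrite -ltNge => rhoz.
  apply: le_trans Fp_le _; apply: le_trans (quad_ge z); rewrite lee_fin.
  rewrite mulrC -ler_pdivrMr//.
  apply: le_trans (sqr_norm_le_dotp _).
  have Mk0 : 0 <= M / k by rewrite divr_ge0// ltW.
  have rho1 : 1 + M / k <= `|z - x0|.
    apply: le_trans (coord_le_norm (z - x0) i); apply: le_trans (ltW rhoz).
    by rewrite le_max lexx orbT.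
  apply: (@le_trans _ _ (1 + M / k)); first by rewrite lerDr.
  by rewrite (le_trans rho1)// expr2 ler_peMl// (le_trans _ rho1)// lerDl.
have [v phiv] : exists v, phi p = v%:E.
  move: (le_trans (phi_ge p) Fp_le) (phiN p).
  by case: (phi p) => [w| |]// _ _; exists w.
by exists p, v; split=> // z; have := pmin z; rewrite {1}/F phiv -EFinD.
Qed.

(* The first-order condition at the minimizer [p] of the Moreau envelope says
   that [2 k (x0 - p)] is a subgradient of [phi] at [p]. *)
Lemma moreau_envelope_subgradient (k v : R) (x0 p z : 'rV[R]_n) : 0 < k ->
  phi p = v%:E ->
  (forall z, ((v + k * dotp (p - x0) (p - x0))%:E <=
    phi z + (k * dotp (z - x0) (z - x0))%:E)%E) ->
  ((v - 2 * k * dotp (p - x0) (z - p))%:E <= phi z)%E.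
Proof.
case: cphi => phiN _ conv _ k0 phiv pmin.
case E : (phi z) (phiN z) => [w| |]// _; last by rewrite leey.
rewrite lee_fin.
set A := p - x0; set B := z - p.
(* Minimality is tested at $p + l(z-p)$; convexity bounds $\varphi$ there, and the result is divided
   by $l$. *)
have key l : 0 < l <= 1 -> 0 <= (w - v + 2 * k * dotp A B) + l * (k * dotp B B).
  move=> /andP[l0 l1].
  have convl : (phi (l *: z + (1 - l) *: p)%R <= (l * w + (1 - l) * v)%:E)%E.
    by have := conv z p l; rewrite E phiv -!EFinM -EFinD; apply; rewrite ltW.
  have ABE : l *: z + (1 - l) *: p - x0 = A + l *: B.
    by apply/rowP => i; rewrite !mxE; ring.
  have := le_trans (pmin _) (leeD2r _ convl).
  rewrite -EFinD lee_fin ABE sqdistD -/A.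
  by move=> H; rewrite -(pmulr_rge0 _ l0); lra.
rewrite leNgt; apply/negP => H.
set C := k * dotp B B; have C0 : 0 <= C by rewrite mulr_ge0 ?dotp_ge0 ?ltW.
pose c := v - 2 * k * dotp A B - w.
have c0 : 0 < c by rewrite subr_gt0.
have cC : 0 < c + C by rewrite ltr_pwDl.
(* This $l$ is at most 1 and satisfies $lC < c$, whereas [key] demands $c \le lC$. *)
have := key (c / (c + C)); rewrite divr_gt0//= ler_pdivrMr// mul1r lerDl.
move=> /(_ C0).
have -> : w - v + 2 * k * dotp A B = - c by rewrite /c; ring.
rewrite addrC subr_ge0 -/C leNgt => /negP; apply.
rewrite mulrAC ltr_pdivrMr// mulrDr ltrDr; exact: mulr_gt0.
Qed.

(** The minorant supports $\varphi$ at the minimizer $p$ of the envelope centered at $x_0$; its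
    value at $x_0$ is $\varphi(p) + 2k|p-x_0|^2$. This also covers $\varphi(x_0) = +\infty$. *)
Lemma affine_minorant (x0 : 'rV[R]_n) (a : R) : (a%:E < phi x0)%E ->
  exists y b, (forall z, ((dotp y z + b)%:E <= phi z)%E) /\ a < dotp y x0 + b.
Proof.
move=> aphi; case: (cphi) => _ _ _ lphi.
have [V /nbhs_ballP[r /= r0 rV] Vphi] := lphi x0 a aphi.
(* With this $k$, a minimizer at distance at least $r$ has $k|p-x_0|^2 \ge |a|+1$; a closer one has
   $\varphi(p) > a$ by lower semicontinuity. *)
pose k := (`|a| + 1) / r ^+ 2.
have k0 : 0 < k by rewrite divr_gt0 ?exprn_gt0// ltr_pwDr.
have [p [v [phiv pmin]]] := moreau_envelope_argmin x0 k0.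
have sub z := moreau_envelope_subgradient z k0 phiv pmin.
exists ((- (2 * k)) *: (p - x0)), (v + 2 * k * dotp (p - x0) p); split => [z|].
  apply: le_trans (sub z); rewrite lee_fin dotpZl dotpDr dotpNr.
  lra.
have -> : dotp (- (2 * k) *: (p - x0)) x0 + (v + 2 * k * dotp (p - x0) p) =
    v + 2 * k * dotp (p - x0) (p - x0).
  by rewrite dotpZl [in RHS]dotpDr dotpNr; ring.
have v0 : 0 <= v by rewrite -lee_fin -phiv.
have [pr|rp] := ltP `|p - x0| r.
  have /rV/Vphi : ball x0 r p by rewrite -ball_normE /= distrC.
  rewrite phiv lte_fin => /lt_le_trans; apply.
  by rewrite lerDl mulr_ge0 ?dotp_ge0// mulr_ge0// ltW.
have rD : r ^+ 2 <= dotp (p - x0) (p - x0).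
  by rewrite (le_trans _ (sqr_norm_le_dotp _))// ler_pXn2r ?nnegrE// ltW.
have : k * r ^+ 2 <= k * dotp (p - x0) (p - x0) by rewrite ler_pM2l.
rewrite /k divfK ?expf_neq0 ?gt_eqF// -/k.
have := ler_norm a; have : 0 <= k * dotp (p - x0) (p - x0) by rewrite mulr_ge0 ?dotp_ge0 ?ltW.
lra.
Qed.

(** One inequality is Fenchel-Young at $z = x/s$, multiplied by $s$. For the other, given $b <
    s\varphi(z)$, the supremum is tested at the slope of an affine minorant exceeding $b/s$ at
    $z$. *)
Lemma legendre_scale_legendre (s : R) (x : 'rV[R]_n) : 0 < s ->
  legendre (fun y => (s%:E * legendre phi y)%E) x =
  (s%:E * phi (s^-1 *: x)%R)%E.
Proof.
move=> s0; set z := s^-1 *: x.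
have xE : x = s *: z by rewrite /z scalerA divff ?gt_eqF// scale1r.
apply/eqP; rewrite eq_le; apply/andP; split.
  apply: ub_ereal_sup => _ [y _ <-].
  case E : (phi z) => [w| |]; last 2 first.
  - by rewrite gt0_muley ?lte_fin// leey.
  - by case: cphi => /(_ z); rewrite E.
  have : ((dotp z y - w)%:E <= legendre phi y)%E.
    by apply: ereal_sup_ubound; exists z => //; rewrite E EFinB dotpC.
  case: (legendre phi y) => [u| |]//.
  - rewrite -!EFinM -!EFinB !lee_fin => /(ler_wpM2l (ltW s0)).
    by rewrite xE dotpZr (dotpC y); lra.
  - by move=> _; rewrite gt0_muley ?lte_fin// leNye.
rewrite leNgt; apply/negP => /ereal_lt_between[b /andP[lb bs]].
have : ((b / s)%:E < phi z)%E.
  by rewrite mulrC EFinM lte_pdivrMl.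
move=> /affine_minorant[y [c [yc bc]]].
have : (legendre phi y <= (- c)%:E)%E.
  apply: ub_ereal_sup => _ [u _ <-].
  have := yc u; case: (phi u) => [w| |]//.
  - by rewrite -EFinB !lee_fin (dotpC u); lra.
  - by move=> _; rewrite leNye.
move=> leg.
have : ((dotp y x)%:E - s%:E * legendre phi y <= legendre (fun y => (s%:E * legendre phi y)%E) x)%E.
  by apply: ereal_sup_ubound; exists y.
move=> /le_lt_trans /(_ lb); apply/negP; rewrite -leNgt.
have : (s%:E * legendre phi y <= (s * - c)%:E)%E.
  by rewrite EFinM lee_pmul2l.
move=> /(leeB (lexx (dotp y x)%:E)); apply: le_trans.
rewrite -EFinB lee_fin xE dotpZr; move: bc; rewrite ltr_pdivrMr//; nra.
Qed.

End Biconjugate.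
End FenchelMoreau.

(** * Signed integrals and dilations through the parametrization of [nnintRn_representation] *)

Section IteratedIntegral.
Context {R : realType} {n : nat} d (T : measurableType d)
  (mu : {measure set T -> \bar R}) (e : T -> 'rV[R]_n).
Hypothesis De : forall c : R,
  exists2 D : T -> T, measurable_fun setT D & forall z, e (D z) = c *: e z.
Hypothesis Ie : forall g, (forall x, 0 <= g x)%E ->
  measurable_fun setT (g \o e) -> nnintRn g = (\int[mu]_z g (e z))%E.
Hypothesis Se : forall g (c : R), 0 < c -> (forall x, 0 <= g x)%E ->
  measurable_fun setT (g \o e) ->
  nnintRn (fun x => g (c^-1 *: x)) = ((c ^+ n)%:E * nnintRn g)%E.

Lemma intRn_integral (g : 'rV[R]_n -> R) : measurable_fun setT (g \o e) ->
  intRn g = (\int[mu]_z (g (e z))%:E)%E.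
Proof.
move=> mg; rewrite /intRn integralE !Ie.
- congr (_ - _)%E; apply: eq_integral => z _.
    by rewrite funeposE EFin_max.
  by rewrite funenegE EFin_max.
- by move=> x; rewrite lee_fin le_max lexx orbT.
- apply/measurable_EFinP; apply: measurable_maxr; last exact: measurable_cst.
  by apply: measurableT_comp mg; exact: oppr_measurable.
- by move=> x; rewrite lee_fin le_max lexx orbT.
- by apply/measurable_EFinP; apply: measurable_maxr => //; exact: measurable_cst.
Qed.

Lemma measurable_dilation (g : 'rV[R]_n -> R) (s : R) :
  measurable_fun setT (g \o e) ->
  measurable_fun setT ((fun x => g (s *: x)) \o e).
Proof.
move=> mg; have [D mD DE] := De s.
rewrite (_ : _ \o _ = (g \o e) \o D); first exact: measurableT_comp.
by apply/funext => z /=; rewrite DE.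
Qed.

Lemma integral_dilation (g : 'rV[R]_n -> R) (s : R) : 0 < s ->
  (forall x, 0 <= g x) -> measurable_fun setT (g \o e) ->
  (\int[mu]_z (g (s^-1 *: e z))%:E = (s ^+ n)%:E * \int[mu]_z (g (e z))%:E)%E.
Proof.
move=> s0 g0 mg.
have gE0 x : (0 <= (EFin \o g) x)%E by rewrite /= lee_fin.
have mgE : measurable_fun setT ((EFin \o g) \o e) by exact/measurable_EFinP.
rewrite -(Ie (g := fun x => (g (s^-1 *: x))%:E)).
- by rewrite (Se s0 gE0 mgE) (Ie gE0 mgE).
- by move=> x; rewrite lee_fin.
- by apply/measurable_EFinP; exact: measurable_dilation.
Qed.

End IteratedIntegral.

(** * Pointwise first-order expansion of the perturbation *)

Section AlphaPerturbation.
Context {R : realType} {n : nat} (alpha beta1 beta2 : R)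
  (phi : 'rV[R]_n -> \bar R).
Hypotheses (alpha0 : alpha < 0) (beta1_ge0 : 0 <= beta1)
  (cphi : in_Conv phi) (phi0 : forall x, (0 <= phi x)%E).

Local Notation p := (- alpha^-1).

(** The function $G_t$: the perturbation before dilation by $s = 1+\beta_1 t$. *)
Definition alpha_pert (t : R) (x : 'rV[R]_n) : R :=
  if phi x == +oo%E then 0
  else (1 - alpha * ((1 + beta1 * t) * fine (phi x)) + alpha * beta2 * t) `^ alpha^-1.

Lemma fhat_alpha_pert (t : R) x : 0 <= t ->
  fhat alpha beta1 beta2 phi t x = alpha_pert t ((1 + beta1 * t)^-1 *: x).
Proof.
move=> t0; have s0 : 0 < 1 + beta1 * t by rewrite ltr_pwDl// mulr_ge0.
rewrite /fhat legendre_scale_legendre// /alpha_pert.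
case E : (phi _) => [w| |].
- by rewrite -EFinM.
- by rewrite gt0_muley ?lte_fin// eqxx.
- by have [/(_ ((1 + beta1 * t)^-1 *: x))] := cphi; rewrite E.
Qed.

Lemma alpha_fun_ge0 x : 0 <= alpha_fun alpha phi x.
Proof. by rewrite /alpha_fun; case: ifP => // _; exact: powR_ge0. Qed.

(** With $u = 1-\alpha\varphi > 0$ one has $u^{(1-\alpha)/\alpha} = u^{1/\alpha}/u$. Where $\varphi
    = +\infty$, the power of 0 is 0 because $1-\alpha \ne 0$. *)
Lemma alpha_fun_pow x : alpha_fun alpha phi x `^ (1 - alpha) =
  if phi x == +oo%E then 0
  else alpha_fun alpha phi x * (1 - alpha * fine (phi x))^-1.
Proof.
rewrite /alpha_fun; case: ifP => [_|/negbT phioo].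
  by rewrite powR0// gt_eqF// subr_gt0 (lt_trans alpha0).
have u0 : 0 < 1 - alpha * fine (phi x).
  by rewrite subr_gt0 (le_lt_trans _ ltr01)// mulr_le0_ge0 ?fine_ge0// ltW.
rewrite -powRrM mulrBr mulr1 mulVf ?lt_eqF//.
by rewrite powRB ?powRr1 ?ltW// (gt_eqF u0) implybT.
Qed.

Lemma alpha_fun_pow_le x :
  0 <= alpha_fun alpha phi x `^ (1 - alpha) <= alpha_fun alpha phi x.
Proof.
rewrite powR_ge0 alpha_fun_pow; case: ifP => _; first exact: alpha_fun_ge0.
rewrite ler_piMr ?alpha_fun_ge0// invf_le1.
  by rewrite lerBrDr gerDl mulr_le0_ge0 ?fine_ge0// ltW.
by rewrite subr_gt0 (le_lt_trans _ ltr01)// mulr_le0_ge0 ?fine_ge0// ltW.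
Qed.

(** This is $f - t\,p w f$, with $f/u$ written as $f^{1-\alpha}$ so that it is a linear combination
    of two integrable functions. *)
Definition alpha_pert1 (t : R) (x : 'rV[R]_n) : R :=
  (1 - t * (p * beta1)) * alpha_fun alpha phi x +
  t * (p * beta1 + beta2) * alpha_fun alpha phi x `^ (1 - alpha).

Local Notation K := (beta1 + `|alpha * beta2|).

(** This is [powR_taylor1] at $z = tw$, multiplied by $f = u^{-p}$. Since $u \ge 1$, [K] bounds
    $|w|$ at every $x$, so the admissible range of $t$ is uniform. *)
Lemma alpha_pert_taylor1 (t : R) x : 0 <= t -> (p + 1) * (t * K) <= 2^-1 ->
  alpha_pert1 t x <= alpha_pert t x <=
  alpha_pert1 t x + 2 * p * (p + 1) * K ^+ 2 * t ^+ 2 * alpha_fun alpha phi x.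
Proof.
move=> t0 tK.
have p0 : 0 < p by rewrite oppr_gt0 invr_lt0.
rewrite /alpha_pert1 /alpha_pert alpha_fun_pow /alpha_fun.
case: ifPn => [_|phioo]; first by rewrite !(mulr0, addr0) lexx.
set v := fine (phi x).
have v0 : 0 <= v by exact: fine_ge0.
set u := 1 - alpha * v.
have u1 : 1 <= u by rewrite lerDl oppr_ge0 mulr_le0_ge0// ltW.
have u0 : 0 < u by exact: lt_le_trans u1.
pose w := beta1 * (1 - u^-1) + alpha * beta2 / u.
have uV : 0 < u^-1 <= 1 by rewrite invr_gt0 u0 invf_le1.
have wK : `|w| <= K.
  rewrite (le_trans (ler_normD _ _))// lerD//.
    rewrite ger0_norm; first by rewrite ler_piMr//; lra.
    by rewrite mulr_ge0//; lra.
  rewrite normrM (gtr0_norm (_ : 0 < u^-1)) ?invr_gt0//.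
  by rewrite ler_piMr//; lra.
have tw : (p + 1) * `|t * w| <= 2^-1.
  rewrite (le_trans _ tK)// ler_wpM2l//; first by lra.
  by rewrite normrM (ger0_norm t0) ler_wpM2l.
have K0 : 0 <= K by rewrite addr_ge0.
(* The perturbed base is affine in $t$ with value $u$ at 0; the choice of [w] comes from this
   factorization. *)
have bE : 1 - alpha * ((1 + beta1 * t) * v) + alpha * beta2 * t = u * (1 + t * w).
  by rewrite /w /u; field; rewrite gt_eqF.
have tw0 : 0 <= 1 + t * w.
  have : `|t * w| <= 2^-1 by rewrite (le_trans _ tw)// ler_peMl//; lra.
  by rewrite ler_norml; lra.
rewrite bE powRM ?(ltW u0)//.
set f := u `^ alpha^-1.
have f0 : 0 <= f by exact: powR_ge0.
have /andP[lo hi] := powR_taylor1 (ltW p0) tw.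
rewrite opprK in lo hi.
have pa : p * alpha = -1 by rewrite mulNr mulVf// lt_eqF.
(* The relation $p\alpha = -1$ turns $p\alpha\beta_2/u$ into $-\beta_2/u$. *)
have lE : (1 - t * (p * beta1)) * f + t * (p * beta1 + beta2) * (f / u) =
    f * (1 - p * (t * w)).
  rewrite (_ : p * (t * w) = t * (p * beta1 * (1 - u^-1) + (p * alpha) * beta2 / u)).
    by rewrite pa; field; rewrite (gt_eqF u0) (lt_eqF alpha0).
  by rewrite /w; field; rewrite (gt_eqF u0) (lt_eqF alpha0).
rewrite lE; apply/andP; split.
  by rewrite ler_wpM2l// -subr_ge0.
have wK2 : (t * w) ^+ 2 <= K ^+ 2 * t ^+ 2.
  rewrite exprMn mulrC ler_wpM2r ?sqr_ge0// -real_normK ?num_real//.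
  by rewrite ler_pXn2r ?nnegrE.
rewrite -lerBlDl -mulrBr mulrC ler_wpM2r//.
apply: le_trans hi _.
rewrite -(mulrA (2 * p * (p + 1))) ler_wpM2l//.
by rewrite !mulr_ge0//; lra.
Qed.

Lemma measurable_alpha_pert d (T : measurableType d) (e : T -> 'rV[R]_n) (t : R) :
  (forall i, measurable_fun setT (fun z => e z ord0 i)) ->
  measurable_fun setT (alpha_pert t \o e).
Proof.
move=> me; have mphi : measurable_fun setT (phi \o e).
  by case: cphi => _ _ _; exact: measurable_fun_lower_semicontinuous.
apply: measurable_fun_ifT.
- exact: (@measurable_fun_eqe _ _ _ _ (phi \o e) (cst +oo%E)).
- exact: measurable_cst.
- apply: (measurableT_comp (measurable_powR _)).
  apply: measurable_funD; last exact: measurable_cst.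
  apply: measurable_funB; first exact: measurable_cst.
  apply: measurable_funM; first exact: measurable_cst.
  apply: measurable_funM; first exact: measurable_cst.
  exact: (measurableT_comp (fine_measurable measurableT)).
Qed.

End AlphaPerturbation.

(** * Integrability of $f$ and $f^{1-\alpha}$ *)

Section Integrability.
Context {R : realType} {m : nat} d (T : measurableType d)
  (mu : {measure set T -> \bar R}) (e : T -> 'rV[R]_m.+1).
Hypothesis me : forall i, measurable_fun setT (fun z => e z ord0 i).
Hypothesis Ie : forall g, (forall x, 0 <= g x)%E ->
  measurable_fun setT (g \o e) -> nnintRn g = (\int[mu]_z g (e z))%E.
Context (alpha : R) (phi : 'rV[R]_m.+1 -> \bar R).
Hypotheses (alphan : - (m.+1%:R)^-1 < alpha) (alpha0 : alpha < 0)
  (Cphi : C_alpha_plus_fun phi).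

Lemma alpha_fun_tail : exists2 C : R, 0 <= C &
  forall x, alpha_fun alpha phi x <= C * (1 + `|x|) `^ alpha^-1.
Proof.
case: Cphi => _ phi0 [c [c0 [r0 phic]]].
(* Chosen so that $k(1+|x|) \le 1-\alpha\varphi(x)$: the first bound serves $|x| < r_0$, where the
   right side is at least 1; the other two serve $|x| \ge r_0$, where $\varphi(x) \ge c|x|$. *)
pose k := Num.min (1 + `|r0|)^-1 (Num.min 1 (- alpha * c)).
have k0 : 0 < k.
  by rewrite !lt_min ltr01 invr_gt0 ltr_pwDl//= mulr_gt0// oppr_gt0.
exists (k `^ alpha^-1); first exact: powR_ge0.
move=> x; rewrite -powRM ?(ltW k0) ?addr_ge0//.
rewrite /alpha_fun; case: ifPn => [_|phioo]; first exact: powR_ge0.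
have pos : 0 < k * (1 + `|x|) by rewrite mulr_gt0// ltr_pwDl.
have fine0 : 0 <= fine (phi x) by exact: fine_ge0.
have u1 : 1 <= 1 - alpha * fine (phi x).
  by rewrite lerDl oppr_ge0 mulr_le0_ge0// ltW.
have ku : k * (1 + `|x|) <= 1 - alpha * fine (phi x).
  have [xr|rx] := ltP `|x| r0.
    apply: le_trans u1.
    have : k <= (1 + `|r0|)^-1 by rewrite ge_min lexx.
    move=> /(ler_wpM2r (_ : 0 <= 1 + `|x|)); rewrite addr_ge0// => /(_ isT) /le_trans; apply.
    rewrite mulrC ler_pdivrMr ?ltr_pwDl// mul1r lerD2l.
    by rewrite (le_trans (ltW xr))// ler_norm.
  have cx : c * `|x| <= fine (phi x).
    have := phic x rx; have := phi0 x; case: (phi x) phioo => [w| |]//.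
  have k1 : k <= 1 by rewrite !ge_min lexx orbT.
  have kc : k <= - alpha * c by rewrite !ge_min lexx !orbT.
  rewrite mulrDr mulr1 -mulNr lerD//.
  apply: (@le_trans _ _ (- alpha * c * `|x|)); first by rewrite ler_wpM2r.
  by rewrite -mulrA ler_wpM2l// oppr_ge0 ltW.
rewrite -(opprK alpha^-1) !(powRN _ (- alpha^-1)) lef_pV2 ?posrE ?powR_gt0 ?(lt_le_trans pos ku)//.
by apply: ge0_ler_powR; rewrite ?nnegrE ?oppr_ge0 ?invr_le0 ?(ltW alpha0) ?(ltW pos) ?(le_trans ler01).
Qed.

Lemma measurable_alpha_fun : measurable_fun setT (alpha_fun alpha phi \o e).
Proof.
have [cphi _ _] := Cphi.
rewrite (_ : alpha_fun alpha phi = alpha_pert alpha 0 0 phi 0).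
  exact: measurable_alpha_pert.
by apply/funext => x; rewrite /alpha_pert !(mulr0, mul0r, addr0, mul1r).
Qed.

(** The tail bound majorizes $f$ by a product of one-variable tails, whose iterated integral is an
    explicit finite power. *)
Lemma integrable_alpha_fun :
  mu.-integrable setT (EFin \o (alpha_fun alpha phi \o e)).
Proof.
have [C C0 fC] := alpha_fun_tail.
(* The exponent available to each coordinate; $q > 1$ is exactly $\alpha > -1/n$ with $n = m+1$. *)
pose q := - alpha^-1 / m.+1%:R.
have q1 : 1 < q.
  rewrite /q ltr_pdivlMr// mul1r -invrN -[ltLHS]invrK ltf_pV2 ?posrE ?invr_gt0 ?oppr_gt0//.
  by rewrite ltrNl.
pose tail (y : R) : R := (1 + `|y|) `^ (- q).
have tail0 y : 0 <= tail y by exact: powR_ge0.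
have mtail : measurable_fun [set: R] tail.
  by apply: continuous_measurable_fun; exact: continuous_power_tail.
pose h (x : 'rV[R]_m.+1) := C * \prod_(i < m.+1) tail (x ord0 i).
have h0 x : 0 <= h x by rewrite mulr_ge0// prodr_ge0.
have mh : measurable_fun setT (h \o e).
  apply: measurable_funM; first exact: measurable_cst.
  apply: measurable_prod => i _.
  exact: (measurableT_comp mtail).
have fh x : alpha_fun alpha phi x <= h x.
  apply: le_trans (fC x) _; rewrite ler_wpM2l//.
  rewrite -[X in _ `^ X]opprK; apply: norm_tail_le_prod.
  by rewrite oppr_ge0 invr_le0 ltW.
have If : (\int[@lebesgue_measure R]_x (tail x)%:E)%E \is a fin_num.
  rewrite ge0_fin_numE; first exact: integral_power_tail_lty.
  by apply: integral_ge0 => x _; rewrite lee_fin.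
apply: (le_integrable measurableT (g := EFin \o (h \o e))).
- by apply/measurable_EFinP; exact: measurable_alpha_fun.
- move=> x _ /=; rewrite lee_fin ger0_norm ?alpha_fun_ge0//.
  by rewrite ger0_norm.
- apply/integrableP; split; first exact/measurable_EFinP.
  under eq_integral do rewrite /= ger0_norm//.
  rewrite -(Ie (g := EFin \o h)).
  + by rewrite (nnintRn_prod _ tail0 mtail (esym (fineK If)))// ltry.
  + by move=> x; rewrite /= lee_fin.
  + exact/measurable_EFinP.
Qed.

Lemma integrable_alpha_fun_pow : mu.-integrable setT
  (EFin \o ((fun x => alpha_fun alpha phi x `^ (1 - alpha)) \o e)).
Proof.
have [cphi phi0 _] := Cphi.
apply: (le_integrable measurableT _ _ integrable_alpha_fun).
  apply/measurable_EFinP; apply: (measurableT_comp (measurable_powR _)).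
  exact: measurable_alpha_fun.
move=> z _ /=; rewrite lee_fin.
have /andP[f0 f1] := alpha_fun_pow_le alpha0 phi0 (e z).
by rewrite ger0_norm// ger0_norm// (le_trans f0).
Qed.

End Integrability.

(** * Limit of a dilated difference quotient *)

Section DifferenceQuotient.
Context {R : realType}.

(** With $s = 1+bt$ the quotient is $bA\sum_{i<n} s^i - s^n D + s^n r$, where $0 \le r \le Ct$; each
    term has an immediate limit. *)
Lemma cvg_dilated_quotient (n : nat) (A D C b : R) (g : R -> R) :
  (\forall t \near 0^'+, 0 <= g t - (A - t * D) <= C * t ^+ 2) ->
  ((1 + b * t) ^+ n * g t - A) / t @[t --> 0^'+] --> n%:R * b * A - D.
Proof.
move=> gt.
have s1 : (1 + b * t) @[t --> 0^'+] --> (1 : R).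
  rewrite -[X in _ --> X]addr0 -[X in _ --> _ + X](mulr0 b).
  apply: cvg_at_right_filter; apply: cvgD; first exact: cvg_cst.
  by apply: cvgM; [exact: cvg_cst|exact: cvg_id].
have sX k : (1 + b * t) ^+ k @[t --> 0^'+] --> (1 : R).
  rewrite -[X in _ --> X](expr1n R k).
  apply: (@cvg_comp _ _ _ (fun t => 1 + b * t) (fun x : R => x ^+ k) _ _ _ s1).
  exact: exprn_continuous.
pose r t := (g t - (A - t * D)) / t.
have r0 : r t @[t --> 0^'+] --> (0 : R).
  apply: (@squeeze_cvgr _ _ _ _ (cst 0) (fun t => C * t)).
  - near=> t; have t0 : 0 < t by near: t; exact: nbhs_right_gt.
    have /andP[lo hi] : 0 <= g t - (A - t * D) <= C * t ^+ 2 by near: t.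
    by rewrite /r divr_ge0 ?(ltW t0)//= ler_pdivrMr// -mulrA -expr2.
  - exact: cvg_cst.
  - rewrite -[X in _ --> X](mulr0 C); apply: cvg_at_right_filter.
    by apply: cvgM; [exact: cvg_cst|exact: cvg_id].
have cS : (\sum_(i < n) (1 + b * t) ^+ i) @[t --> 0^'+] --> (n%:R : R).
  rewrite -[n in n%:R]card_ord -sum1_card natr_sum.
  by apply: cvg_big => [|i _]; [exact: add_continuous|exact: sX].
have H : (A * b * (\sum_(i < n) (1 + b * t) ^+ i)
    - (1 + b * t) ^+ n * D + (1 + b * t) ^+ n * r t) @[t --> 0^'+]
    --> A * b * n%:R - 1 * D + 1 * 0.
  apply: cvgD; last exact: (cvgM (sX n) r0).
  apply: cvgB; first exact: (cvgM (cvg_cst _) cS).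
  exact: (cvgM (sX n) (cvg_cst _)).
rewrite (_ : n%:R * b * A - D = A * b * n%:R - 1 * D + 1 * 0); last by ring.
apply: cvg_trans H; apply: near_eq_cvg; near=> t.
have t0 : 0 < t by near: t; exact: nbhs_right_gt.
(* The geometric sum cancels the denominator $t$ without differentiating $s^n$. *)
have sE : (1 + b * t) ^+ n = 1 + b * t * \sum_(i < n) (1 + b * t) ^+ i.
  by rewrite -[LHS](subrK 1) subrX1; ring.
rewrite /r sE; set S := \sum_(_ < _) _.
by field; exact: lt0r_neq0.
Unshelve. all: by end_near. Qed.

End DifferenceQuotient.

(** * Integrated expansion, first variation and the limit *)

Section Expansion.
Context {R : realType} {m : nat} d (T : measurableType d)
  (mu : {measure set T -> \bar R}) (e : T -> 'rV[R]_m.+1).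
Hypothesis me : forall i, measurable_fun setT (fun z => e z ord0 i).
Hypothesis De : forall c : R,
  exists2 D : T -> T, measurable_fun setT D & forall z, e (D z) = c *: e z.
Hypothesis Ie : forall g, (forall x, 0 <= g x)%E ->
  measurable_fun setT (g \o e) -> nnintRn g = (\int[mu]_z g (e z))%E.
Hypothesis Se : forall g (c : R), 0 < c -> (forall x, 0 <= g x)%E ->
  measurable_fun setT (g \o e) ->
  nnintRn (fun x => g (c^-1 *: x)) = ((c ^+ m.+1)%:E * nnintRn g)%E.
Context (alpha : R) (phi : 'rV[R]_m.+1 -> \bar R).
Hypotheses (alphan : - (m.+1%:R)^-1 < alpha) (alpha0 : alpha < 0)
  (Cphi : C_alpha_plus_fun phi).

Local Notation p := (- alpha^-1).
Local Notation f := (alpha_fun alpha phi).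
Local Notation A := (\int[mu]_z f (e z))%R.
Local Notation B := (\int[mu]_z (f (e z) `^ (1 - alpha)))%R.

Let int_f : mu.-integrable setT (EFin \o (f \o e)).
Proof. exact: integrable_alpha_fun. Qed.

Let int_fpow :
  mu.-integrable setT (EFin \o ((fun x => f x `^ (1 - alpha)) \o e)).
Proof. exact: integrable_alpha_fun_pow. Qed.

Let integrable_lin (a b : R) : mu.-integrable setT
  (EFin \o (fun z => a * f (e z) + b * f (e z) `^ (1 - alpha))).
Proof.
rewrite (_ : EFin \o _ = (fun z => a%:E * (EFin \o (f \o e)) z)%E \+
  (fun z => b%:E * (EFin \o ((fun x => f x `^ (1 - alpha))%R \o e)) z)%E)%E.
  by apply: integrableD => //; exact: integrableZl.
by apply/funext => z /=; rewrite EFinD !EFinM.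
Qed.

Let Rintegral_lin (a b : R) :
  (\int[mu]_z (a * f (e z) + b * f (e z) `^ (1 - alpha)))%R = a * A + b * B.
Proof.
have i1 : mu.-integrable setT (EFin \o (fun z => a * f (e z))).
  have := integrable_lin a 0; congr integrable.
  by apply/funext => z /=; rewrite mul0r addr0.
have i2 : mu.-integrable setT (EFin \o (fun z => b * f (e z) `^ (1 - alpha))).
  have := integrable_lin 0 b; congr integrable.
  by apply/funext => z /=; rewrite mul0r add0r.
by rewrite RintegralD// !RintegralZl.
Qed.

Section Perturbation.
Context (beta1 beta2 : R) (beta1_ge0 : 0 <= beta1).

Local Notation K := (beta1 + `|alpha * beta2|).
Local Notation G := (alpha_pert alpha beta1 beta2 phi).
(** The integral of $p w f$. *)
Local Notation D := (p * beta1 * A - (p * beta1 + beta2) * B).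
Local Notation C := (2 * p * (p + 1) * K ^+ 2).

Lemma alpha_pert_ge0 t x : 0 <= G t x.
Proof. by rewrite /alpha_pert; case: ifP => // _; exact: powR_ge0. Qed.

(** Integrates the two-sided bound of [alpha_pert_taylor1], whose upper half also dominates $G_t$
    and so makes it integrable. *)
Lemma alpha_pert_integral (t : R) : 0 <= t -> (p + 1) * (t * K) <= 2^-1 ->
  mu.-integrable setT (EFin \o (G t \o e)) /\
  0 <= (\int[mu]_z G t (e z))%R - (A - t * D) <= C * A * t ^+ 2.
Proof.
move=> t0 tK; have [cphi phi0 _] := Cphi.
have GE z := alpha_pert_taylor1 alpha0 beta1_ge0 phi0 (e z) t0 tK.
pose c1 := 1 - t * (p * beta1); pose c2 := t * (p * beta1 + beta2).
have hiE z : alpha_pert1 alpha beta1 beta2 phi t (e z) + C * t ^+ 2 * f (e z) =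
    (c1 + C * t ^+ 2) * f (e z) + c2 * f (e z) `^ (1 - alpha).
  by rewrite /alpha_pert1 /c1 /c2; ring.
have iG : mu.-integrable setT (EFin \o (G t \o e)).
  apply: (le_integrable measurableT _ _ (integrable_lin (c1 + C * t ^+ 2) c2)).
    by apply/measurable_EFinP; exact: measurable_alpha_pert.
  move=> z _ /=; rewrite lee_fin -hiE ger0_norm ?alpha_pert_ge0//.
  by have /andP[_ Ghi] := GE z; rewrite (le_trans Ghi)// ler_norm.
split=> //.
have lo : c1 * A + c2 * B <= (\int[mu]_z G t (e z))%R.
  rewrite -Rintegral_lin; apply: le_Rintegral => // z _.
  by have /andP[] := GE z.
have hi : (\int[mu]_z G t (e z))%R <= (c1 + C * t ^+ 2) * A + c2 * B.
  rewrite -Rintegral_lin; apply: le_Rintegral => // z _.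
  by rewrite -hiE; have /andP[] := GE z.
have -> : A - t * D = c1 * A + c2 * B by rewrite /c1 /c2; ring.
rewrite subr_ge0 lo /= lerBlDr (le_trans hi)// le_eqVlt; apply/orP; left.
by apply/eqP; ring.
Qed.

Lemma near0_alpha_pert : \forall t \near 0^'+,
  0 < t /\ (p + 1) * (t * K) <= 2^-1.
Proof.
have p0 : 0 < p by rewrite oppr_gt0 invr_lt0.
have K0 : 0 <= K by rewrite addr_ge0.
(* [K] may vanish; [K + 1] keeps the threshold for $t$ positive. *)
have M0 : 0 < (2 * ((p + 1) * (K + 1)))^-1 by rewrite invr_gt0 !mulr_gt0//; lra.
near=> t.
have t0 : 0 < t by near: t; exact: nbhs_right_gt.
split=> //.
have tM : t * (2 * ((p + 1) * (K + 1))) <= 1.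
  rewrite -ler_pdivlMr; last by rewrite -invr_gt0.
  rewrite div1r; apply: ltW.
  by near: t; exact: nbhs_right_lt.
have -> : (p + 1) * (t * K) = t * (2 * ((p + 1) * (K + 1))) / 2 - (p + 1) * t.
  by field; rewrite lt_eqF.
apply: (@le_trans _ _ (t * (2 * ((p + 1) * (K + 1))) / 2)).
  by rewrite gerBl mulr_ge0// ?(ltW t0)// addr_ge0// ltW.
by rewrite ler_pdivrMr// mulVf.
Unshelve. all: by end_near. Qed.

Lemma integral_fhat (t : R) : 0 <= t -> (p + 1) * (t * K) <= 2^-1 ->
  mu.-integrable setT (EFin \o (fhat alpha beta1 beta2 phi t \o e)) /\
  (\int[mu]_z (fhat alpha beta1 beta2 phi t (e z))%:E =
    ((1 + beta1 * t) ^+ m.+1 * (\int[mu]_z G t (e z))%R)%:E)%E.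
Proof.
move=> t0 tK; have [cphi phi0 _] := Cphi.
have s0 : 0 < 1 + beta1 * t by rewrite ltr_pwDl// mulr_ge0.
have [iG _] := alpha_pert_integral t0 tK.
have mG : measurable_fun setT (G t \o e) by exact: measurable_alpha_pert.
have fE : fhat alpha beta1 beta2 phi t = fun x => G t ((1 + beta1 * t)^-1 *: x).
  by apply/funext => x; rewrite fhat_alpha_pert.
have IE : (\int[mu]_z (fhat alpha beta1 beta2 phi t (e z))%:E =
    ((1 + beta1 * t) ^+ m.+1 * (\int[mu]_z G t (e z))%R)%:E)%E.
  rewrite fE (integral_dilation De Ie Se s0 (alpha_pert_ge0 t) mG) EFinM.
  by rewrite /Rintegral fineK//; exact: integrable_fin_num.
split=> //; apply/integrableP; split.
  by rewrite fE; apply/measurable_EFinP; exact: measurable_dilation.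
under eq_integral => z _.
  rewrite /= ger0_norm; last by rewrite fE alpha_pert_ge0.
  over.
by rewrite IE ltry.
Qed.

(** Serves twice: with the given $\beta_1, \beta_2$ for the limit formula, and with $1, 0$ for
    [deltaJ]. *)
Lemma cvg_quotient_fhat :
  (((1 + beta1 * t) ^+ m.+1 * (\int[mu]_z G t (e z))%R - A) / t)%:E
    @[t --> 0^'+] --> (m.+1%:R * beta1 * A - D)%:E.
Proof.
apply: cvg_EFin; first exact: nearW.
apply: (@cvg_dilated_quotient _ _ A D (C * A)).
near=> t.
have [t0 tK] : 0 < t /\ (p + 1) * (t * K) <= 2^-1.
  by near: t; exact: near0_alpha_pert.
by have [] := alpha_pert_integral (ltW t0) tK.
Unshelve. all: by end_near. Qed.

End Perturbation.

Let integral_f : (\int[mu]_z (f (e z))%:E)%E = A%:E.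
Proof. by rewrite /Rintegral fineK//; exact: integrable_fin_num. Qed.

Lemma J_alpha_fun : J f = A%:E.
Proof.
by rewrite /J (intRn_integral Ie)//; exact: measurable_alpha_fun.
Qed.

Lemma intRn_alpha_fun_pow : intRn (fun x => f x `^ (1 - alpha)) = B%:E.
Proof.
rewrite (intRn_integral Ie); last exact/measurable_EFinP/(measurable_int mu int_fpow).
by rewrite /Rintegral fineK//; exact: integrable_fin_num.
Qed.

(** The identity $\varphi^* + t\varphi^* = (1+t)\varphi^*$ holds at infinite values too, because
    both coefficients are nonnegative. *)
Lemma alpha_sum_fhat (t : R) : 0 <= t ->
  alpha_sum alpha phi phi t = fhat alpha 1 0 phi t.
Proof.
move=> t0; apply/funext => x; rewrite /alpha_sum /alpha_fun /fhat.
have -> : (fun y => legendre phi y + t%:E * legendre phi y)%E =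
    (fun y => (1 + 1 * t)%:E * legendre phi y)%E.
  by apply/funext => y; rewrite mul1r EFinD ge0_muleDl// mul1e.
by rewrite mulr0 mul0r addr0.
Qed.

Lemma deltaJ_alpha_fun :
  deltaJ alpha phi phi = (m.+1%:R * A - (p * A - p * B))%:E.
Proof.
have : (((J (alpha_sum alpha phi phi t) - J f) * (t^-1)%:E)%E @[t --> 0^'+] -->
    (m.+1%:R * 1 * A - (p * 1 * A - (p * 1 + 0) * B))%:E).
  apply: cvg_trans (@cvg_quotient_fhat 1 0 ler01).
  apply: near_eq_cvg; near=> t.
  have [t0 tK] : 0 < t /\ (p + 1) * (t * (1 + `|alpha * 0|)) <= 2^-1.
    by near: t; exact: near0_alpha_pert.
  rewrite alpha_sum_fhat ?(ltW t0)// J_alpha_fun /J (intRn_integral Ie).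
    by have [_ ->] := integral_fhat ler01 (ltW t0) tK.
  by have [/measurable_int/measurable_EFinP] := integral_fhat ler01 (ltW t0) tK.
(* [lim] carries information only when convergence is known, so its value is read off from [H]. *)
by move=> H; rewrite /deltaJ (cvg_lim _ H)//; congr EFin; ring.
Unshelve. all: by end_near. Qed.

Lemma cvg_intRn_quotient (beta1 beta2 : R) : 0 <= beta1 ->
  intRn (fun x => (fhat alpha beta1 beta2 phi t x - f x) / t) @[t --> 0^'+] -->
  (m.+1%:R * beta1 * A - (p * beta1 * A - (p * beta1 + beta2) * B))%:E.
Proof.
move=> b0.
apply: cvg_trans (@cvg_quotient_fhat beta1 beta2 b0).
apply: near_eq_cvg; near=> t.
have [t0 tK] : 0 < t /\ (p + 1) * (t * (beta1 + `|alpha * beta2|)) <= 2^-1.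
  by near: t; exact: near0_alpha_pert.
have [ifh IE] := integral_fhat b0 (ltW t0) tK.
have mfh := measurable_int mu ifh.
rewrite (intRn_integral Ie); last first.
  apply: measurable_funM; last exact: measurable_cst.
  apply: measurable_funB; first exact/measurable_EFinP.
  exact: measurable_alpha_fun.
(* Both functions are integrable, so the integral of the quotient is the quotient of the difference
   of the integrals. *)
under eq_integral => z _ do rewrite mulrC EFinM EFinB.
rewrite integralZl//; last exact: integrableB.
by rewrite integralB_EFin// IE integral_f -EFinB -EFinM mulrC.
Unshelve. all: by end_near. Qed.

End Expansion.

(** * Assembly of the limit formula *)

Unset Implicit Arguments.

Theorem theorem3p3 (R : realType) (n : nat) (alpha beta1 beta2 : R)
  (phi : 'rV[R]_n -> \bar R) :
  - (n%:R)^-1 < alpha -> alpha < 0 -> 0 <= beta1 ->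
  C_alpha_plus_fun phi ->
  interior (closure [set x : 'rV[R]_n | phi x != +oo%E]) 0 ->
  exists L : R,
    (fun t : R => intRn (fun x => (fhat alpha beta1 beta2 phi t x - alpha_fun alpha phi x) / t))
      @ 0^'+ --> L%:E
    /\ L%:E = (beta2%:E * intRn (fun x => (alpha_fun alpha phi x `^ (1 - alpha))%R)
               + beta1%:E * deltaJ alpha phi phi)%E.
Proof.
case: n phi => [|m] phi alphan alpha0 beta1_ge0 Cphi _.
  (* For $n = 0$ the convention $0^{-1} = 0$ turns the bounds on $\alpha$ into $0 < \alpha < 0$. *)
  by move: (lt_trans alphan alpha0); rewrite invr0 oppr0 ltxx.
have [d [T [mu [e [me De Ie Se]]]]] := nnintRn_representation (R := R) m.+1.
eexists; split; first exact: (cvg_intRn_quotient me De Ie Se).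
rewrite (intRn_alpha_fun_pow me Ie)// (deltaJ_alpha_fun me De Ie Se)//.
(* With $A = J(f)$ and $B = \int f^{1-\alpha}$, both sides are $\beta_2 B + \beta_1(nA - pA +
   pB)$. *)
by rewrite -!EFinM -EFinD; congr EFin; ring.
Qed.
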